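(* For every $n\in\mathbf{N}$ there are constants $C_n$ and $D_n$, depending only on $n$, such that the following holds. Suppose that for every $j,d\in\mathbf{N}$, $B_j=B_j^{(d)}$ is a $d\times d$ matrix, all of whose entries are $0$ and $1$, with each row and each column having at most one nonzero entry, and for each $d$ let $U$ be a uniformly distributed random $d\times d$ permutation matrix. Then, letting $$f(d)=\max_{1\le j\le 2n}\mathrm{tr}_d(B_j^{(d)}),$$ we have for every $d$ $$\int\mathrm{tr}_d\big(B_1(UB_2U^* )B_3(UB_4U^* )\cdots B_{2n-1}(UB_{2n}U^* )\big)\,dU\le C_nf(d)+D_nd^{-1}.$$ Thus, if $\lim_{d\to\infty}\mathrm{tr}_d(B_j^{(d)})=0$ for all $j$, then $$\lim_{d\to\infty}\int\mathrm{tr}_d\big(B_1(UB_2U^* )B_3(UB_4U^* )\cdots B_{2n-1}(UB_{2n}U^* )\big)\,dU=0.$$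
   Context: $\mathrm{tr}_d=\frac1d\mathrm{Tr}:M_d(\mathbf{C})\to\mathbf{C}$ is the normalized trace. The integral $\int\cdot\,dU$ denotes expectation with respect to the uniform distribution of $U$ over the $d!$ permutation matrices of size $d\times d$. *)

(* Defs.v *)
From HB Require Import structures.
From mathcomp Require Import all_boot all_order all_algebra.
From mathcomp Require Import perm spectral complex.
From mathcomp Require Import reals.

Set Implicit Arguments.
Unset Strict Implicit.
Unset Printing Implicit Defensive.

Import Order.TTheory GRing.Theory Num.Theory.

Local Open Scope ring_scope.
Local Open Scope sesquilinear_scope.

Section Matrices.
Variable R : realType.


Definition ntr (d : nat) (A : 'M[R[i]]_d) : R[i] := d%:R^-1 * \tr A.

Definition partial_perm_mx (d : nat) (A : 'M[R[i]]_d) : Prop :=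
  [/\ forall i j, A i j = 0 \/ A i j = 1,
      forall i, (#|[set j | A i j != 0%R]| <= 1)%N &
      forall j, (#|[set i | A i j != 0%R]| <= 1)%N].

(* [perm_mx] is a bijection from ['S_d] onto the permutation matrices, so this
   is the mean over the [d`!] of them. *)
Definition perm_mean (d : nat) (F : 'M[R[i]]_d -> R[i]) : R[i] :=
  (d`!)%:R^-1 * \sum_(s : 'S_d) F (perm_mx s).

(* B_1 (U B_2 U^* ) B_3 (U B_4 U^* ) ... B_{2n-1} (U B_{2n} U^* ), the factors
   being taken from left to right in increasing order of k. *)
Definition alt_prod (n d : nat) (B : nat -> 'M[R[i]]_d) (U : 'M[R[i]]_d) :
    'M[R[i]]_d :=
  \prod_(k < n) (B k.*2.+1 *m (U *m B k.*2.+2 *m U ^t* )).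

(* The traces are nonnegative reals for the matrices considered, so [Re] loses
   nothing; starting from the term j = 1 makes this, for 0 < n, the maximum of
   exactly the terms 1 <= j <= 2n. *)
Definition max_ntr (n d : nat) (B : nat -> 'M[R[i]]_d) : R :=
  \big[Num.max/complex.Re (ntr (B 1))]_(1 <= j < n.*2.+1)
     complex.Re (ntr (B j)).

End Matrices.

(* Main.v *)
Require Import Defs.
From mathcomp Require Import all_boot all_order all_algebra.
From mathcomp Require Import perm spectral complex reals.

Set Implicit Arguments.
Unset Strict Implicit.
Unset Printing Implicit Defensive.

Import Order.TTheory GRing.Theory Num.Theory.

(** Write U = perm_mx s and regard the B_k as partial injections of the d
    points.  Since (U B U^t* ) u v = B (s u) (s v), the trace of the alternating
    product counts closed walks i_1, i_2, ..., i_2n, i_1, where the k-th step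
    obeys B_k either on the points themselves (k odd) or on their images under s
    (k even).  It remains to bound the number of pairs (s, walk) by
    d! (d * sum_k tr_d B_k + D); dividing by d * d! gives the theorem.

    Each step is a partial injection, so a closed walk is determined by any one
    of its vertices.  Hence, for a fixed s, the closed walks that stand still at
    step k, that is i_k = i_(k+1), are at most as many as the fixed points of
    B_k, namely d * tr_d B_k (card_walks_loop_le).

    The walks that never stand still are O(1) per permutation on average.  Fix
    which of the i_k are equal, and let m be the number of distinct points.
    Join two of these m points when they are the ends of a step of odd rank.
    Every vertex of the walk is an end of exactly one such step, and that step
    joins two different points, so no point is isolated; every connected
    component has at least two points, and a root in each component gives at
    most m/2 vertices whose values determine the walk i
    (half_determining_set).  The steps of even rank act in the same way on the
    image walk s i, so there are at most d^m pairs (i, s i).  Given such a pair,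
    s is prescribed at m points, which leaves at most (d - m)! permutations.
    The total d^m (d - m)! is at most m! d! (expn_fact_le), and there are at most
    (2n)^(2n) ways for the i_k to coincide (card_loopless_walks_le).

    This gives the constants C = 2n and D = (2n)^(2n) (2n)!.  The bound is
    proved with the sum of the 2n normalized traces in place of 2n times their
    maximum, and in this form it also yields the limit, by squeezing. *)

(** * Counting lemmas *)

(** One factor at a time: d <= m.+1 * (d - m) as soon as m < d. *)
Lemma expn_fact_le (d m : nat) : m <= d -> d ^ m * (d - m)`! <= m`! * d`!.
Proof.
elim: m => [|m IH] lmd; first by rewrite expn0 subn0 fact0.
apply: leq_trans (_ : m.+1 * (d ^ m * (d - m)`!) <= _); last first.
  by rewrite factS -mulnA leq_mul2l IH ?orbT // ltnW.
rewrite -[X in d ^ m * X`!]subSS (subSn lmd) factS expnSr mulnCA -mulnA leq_mul2l.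
apply/orP; right; rewrite mulnA leq_mul2r; apply/orP; right.
have {1}-> : d = (d - m.+1).+1 + m by rewrite addSn -addnS subnK.
by rewrite mulSn leq_add2l leq_pmulr.
Qed.

(** If one permutation s0 has the prescribed values, then composing with the
    inverse of s0 turns the others into permutations supported off i @: M. *)
Lemma card_perm_prescribed_le (I X : finType) (M : {set I}) (i j : I -> X) :
  {in M &, injective i} ->
  #|[set s : {perm X} | [forall k in M, s (i k) == j k]]| <= (#|X| - #|M|)`!.
Proof.
move=> injM; set P := [set s | _].
have [->|[s0 s0P]] := set_0Vmem P; first by rewrite cards0.
rewrite -(card_in_imset injM) -{1}(setCK [set i k | k in M]) -cardsCs -card_perm.
rewrite -(card_imset _ (@mulIg _ s0^-1%g)).
apply/subset_leq_card/subsetP => _ /imsetP[s sP ->]; rewrite !inE in sP s0P.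
apply/subsetP => x; rewrite !inE; apply: contraNN => /imsetP[k kM ->].
rewrite permM (eqP (forall_inP sP _ kM)) -(eqP (forall_inP s0P _ kM)).
by rewrite permK.
Qed.

Lemma card_rigid_le (I X : finType) (D : {set I}) (S : {set {ffun I -> X}}) :
  {in S &, forall f g : {ffun I -> X}, {in D, f =1 g} -> f = g} ->
  #|S| <= #|X| ^ #|D|.
Proof.
move=> rigid.
pose res (f : {ffun I -> X}) := [ffun k : {k | k \in D} => f (val k)].
have res_inj : {in S &, injective res}.
  move=> f g fS gS /ffunP eq_fg; apply: rigid => // k kD.
  by have := eq_fg (exist _ k kD); rewrite !ffunE.
by rewrite -(card_in_imset res_inj) -[#|D|]card_sig -card_ffun max_card.
Qed.

(** The graph on the image M of rho that joins rho k to rho (p k) has no isolated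
    vertex.  Take one root in each connected component: a neighbour of a root is
    not a root and lies in the component of that root only, so the roots make up
    at most half of M.  Two functions as below that agree at a root agree on its
    whole component. *)
Lemma half_determining_set (I : finType) (p rho : I -> I) :
  involutive p -> (forall k, rho (rho k) = rho k) ->
  (forall k, rho (p k) != rho k) ->
  exists2 D : {set I}, (#|D|.*2 <= #|[set rho k | k in I]|) &
    forall (X : Type) (f g : I -> X),
      (forall k, f (rho k) = f k) -> (forall k, g (rho k) = g k) ->
      (forall k, f k = g k -> f (p k) = g (p k)) ->
      {in D, f =1 g} -> f =1 g.
Proof.
move=> pK rhoK rho_p; set M := [set rho k | k in I].
pose e : rel I := fun u v => [exists a, (rho a == u) && (rho (p a) == v)].
have e_sym : connect_sym e.
  apply: sym_connect_sym => u v; apply/existsP/existsP => -[a /andP[au av]];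
  by exists (p a); rewrite pK au av.
have eM u v : e u v -> (u \in M) && (v \in M).
  by case/existsP => a /andP[/eqP<- /eqP<-]; rewrite !imset_f.
have e_p u : u \in M -> e u (rho (p u)).
  case/imsetP=> k _ ->; apply/existsP; exists (rho k); rewrite rhoK.
  by rewrite !eqxx.
have clM : closed e M by move=> u v /eM /andP[-> ->].
have inM u : u \in M -> rho u = u by case/imsetP=> k _ ->; rewrite rhoK.
exists [set u in M | fingraph.root e u == u].
  set D := [set u in M | _].
  have DM : D \subset M by apply/subsetP=> u; rewrite inE => /andP[].
  (* A root u injects into the non-roots by its neighbour rho (p u). *)
  rewrite -(cardsID D M) (setIidPr DM) -addnn leq_add2l.
  have root_p u : u \in D -> fingraph.root e (rho (p u)) = u.
    rewrite inE => /andP[uM /eqP {2}<-]; apply/(fingraph.rootP e_sym) => //.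
    by rewrite e_sym connect1 // e_p.
  rewrite -(@card_in_imset _ _ (fun u => rho (p u)) D); last first.
    by move=> u v uD vD /(congr1 (fingraph.root e)); rewrite !root_p.
  apply/subset_leq_card/subsetP => _ /imsetP[u uD ->].
  have uM := subsetP DM _ uD.
  rewrite !inE root_p // imset_f //= andbT eq_sym.
  by apply: contra (rho_p u) => /eqP ->; rewrite inM.
move=> X f g f_rho g_rho f_p fgD k.
have fg_e u v : e u v -> f u = g u -> f v = g v.
  case/existsP => a /andP[/eqP<- /eqP<-].
  by rewrite !f_rho !g_rho; apply: f_p.
have fg_c u v : connect e u v -> f u = g u -> f v = g v.
  case/connectP => q + ->; elim: q u => //= w q IH u /andP[euw pq] fgu.
  by apply: IH pq _; apply: fg_e fgu.
have kM : rho k \in M by rewrite imset_f.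
rewrite -f_rho -g_rho; apply: (fg_c (fingraph.root e (rho k))).
  by rewrite e_sym connect_root.
apply: fgD; rewrite inE (root_root e_sym) eqxx andbT.
by rewrite -(closed_connect clM (connect_root e (rho k))).
Qed.

(** * Closed walks alternating between points and their images *)

Section ClosedWalks.
Variables (X : finType) (n : nat) (b : nat -> rel X).
Hypothesis n_gt0 : 0 < n.

Local Notation I := 'I_(n.*2).

Definition partial_inj (r : rel X) :=
  (forall x y z, r x y -> r x z -> y = z) /\
  (forall x y z, r x z -> r y z -> x = y).

Hypothesis bP : forall k, k < n.*2 -> partial_inj (b k).

(** Indices start from 0 here, so the even k are the steps made by the points
    themselves and the odd k those made by their images under s. *)
Definition step (s : {perm X}) (k : nat) : rel X :=
  fun u v => if odd k then b k (s u) (s v) else b k u v.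

Definition closed_walks (s : {perm X}) : {set {ffun I -> X}} :=
  [set i : {ffun I -> X} | [forall k : I, step s k (i k) (i (ordS k))]].

Lemma step_partial_inj s k : k < n.*2 -> partial_inj (step s k).
Proof.
move=> /bP[fun_b inj_b]; rewrite /step; case: (odd k); split=> x y z.
- by move=> h1 h2; apply: (@perm_inj _ s); apply: fun_b _ _ _ h1 h2.
- by move=> h1 h2; apply: (@perm_inj _ s); apply: inj_b _ _ _ h1 h2.
- exact: fun_b.
- exact: inj_b.
Qed.

(** Steps propagate an agreement from k to its cyclic successor. *)
Lemma closed_walk_determined s (i j : {ffun I -> X}) (k : I) :
  i \in closed_walks s -> j \in closed_walks s -> i k = j k -> i = j.
Proof.
rewrite !inE => /forallP iW /forallP jW eq_k; apply/ffunP => l.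
have eq_iter m : i (iter m (@ordS _) k) = j (iter m (@ordS _) k).
  elim: m => [|m IH] //=; set k' := iter m _ _ in IH *.
  apply: (proj1 (step_partial_inj s (ltn_ord k'))) _ _ _ (iW k') _.
  by rewrite IH; apply: jW.
have val_iter m : val (iter m (@ordS _) k) = (k + m) %% n.*2.
  elim: m => [|m IH] /=; first by rewrite addn0 modn_small.
  by rewrite IH -addn1 modnDml addn1 addnS.
suff <- : iter (l + (n.*2 - k)) (@ordS _) k = l by [].
apply: val_inj; rewrite val_iter addnCA subnKC ?modnDr ?modn_small //.
exact: ltnW.
Qed.

(** A walk standing still at k visits a fixed point of b k there, or its image
    under s does, and that fixed point determines the walk. *)
Lemma card_walks_loop_le s (k : I) :
  #|[set i in closed_walks s | i k == i (ordS k)]| <= #|[set x | b k x x]|.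
Proof.
pose g (i : {ffun I -> X}) := if odd k then s (i k) else i k.
rewrite -(@card_in_imset _ _ g).
  apply/subset_leq_card/subsetP => _ /imsetP[i + ->].
  rewrite !inE /g => /andP[/forallP/(_ k) + /eqP eq_k].
  by rewrite /step -eq_k; case: (odd k).
move=> i j /setIdP[iW _] /setIdP[jW _] eq_g.
apply: (closed_walk_determined (k := k) iW jW).
by move: eq_g; rewrite /g; case: (odd k) => // /perm_inj.
Qed.

Lemma odd_ordS (k : I) : odd (ordS k) = ~~ odd k.
Proof. by rewrite /= odd_mod ?odd_double. Qed.

Lemma odd_ord_pred (k : I) : odd (ord_pred k) = ~~ odd k.
Proof. by have := odd_ordS (ord_pred k); rewrite ord_predK => ->; rewrite negbK. Qed.

(** The steps whose rank has parity c form a perfect matching of the cyclic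
    indices: each k is the start or the end of exactly one of them. *)
Definition partner (c : bool) (k : I) : I :=
  if odd k == c then ordS k else ord_pred k.

Lemma partnerK c : involutive (partner c).
Proof.
move=> k; rewrite /partner; case: (odd k =P c) => [<-|/eqP kc].
  by rewrite odd_ordS ordSK; case: (odd k).
by rewrite odd_ord_pred ord_predK; case: (odd k) c kc => [] [].
Qed.

Lemma partner_determined (c : bool) (f g : I -> X) :
  (forall k : I, odd k = c -> b k (f k) (f (ordS k))) ->
  (forall k : I, odd k = c -> b k (g k) (g (ordS k))) ->
  forall k, f k = g k -> f (partner c k) = g (partner c k).
Proof.
move=> fS gS k eq_k; rewrite /partner; case: (odd k =P c) => [kc|/eqP kc].
  have := gS k kc; rewrite -eq_k => gk.
  exact: (proj1 (bP (ltn_ord k))) _ _ _ (fS k kc) gk.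
have pc : odd (ord_pred k) = c.
  by rewrite odd_ord_pred; case: (odd k) kc; case: (c).
have := fS _ pc; have := gS _ pc; rewrite ord_predK -eq_k => gk fk.
exact: (proj2 (bP (ltn_ord (ord_pred k)))) _ _ _ fk gk.
Qed.

(** A canonical index of the same value: since pick depends only on the extent
    of its predicate, indices of equal values get the same representative, so
    that this function encodes the partition of the indices induced by i. *)
Definition kernel (i : {ffun I -> X}) : {ffun I -> I} :=
  [ffun k => odflt k [pick l | i l == i k]].

Lemma kernelK (i : {ffun I -> X}) k : i (kernel i k) = i k.
Proof. by rewrite ffunE; case: pickP => [l /eqP|]. Qed.

Lemma kernel_eq (i : {ffun I -> X}) k l :
  (kernel i k == kernel i l) = (i k == i l).
Proof.
apply/eqP/eqP => [eq_ker|eq_i]; first by rewrite -kernelK eq_ker kernelK.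
rewrite !ffunE (eq_pick (Q := fun m => i m == i l)) => [|m]; last by rewrite eq_i.
by case: pickP => // /(_ l); rewrite eqxx.
Qed.

Definition loopless_walks (rho : {ffun I -> I}) :=
  [set w : {ffun I -> X} * {perm X} |
    [&& w.1 \in closed_walks w.2, [forall k, w.1 k != w.1 (ordS k)]
      & kernel w.1 == rho]].

Definition image_walk (w : {ffun I -> X} * {perm X}) : {ffun I -> X} :=
  [ffun k => w.2 (w.1 k)].

(** A pair (i, s) is sent to the walk i and to its image under s.  Each of the two
    is determined by at most m/2 of its values, where m = #|M| is the number of
    distinct points, and each fibre fixes s at m points. *)
Lemma card_loopless_walks_le rho :
  #|loopless_walks rho| <= (n.*2)`! * #|X|`!.
Proof.
set W := loopless_walks rho.
have [->|[w0 w0W]] := set_0Vmem W; first by rewrite cards0.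
have WP w : w \in W -> [/\ forall k : I, step w.2 k (w.1 k) (w.1 (ordS k)),
    forall k, w.1 k != w.1 (ordS k) & kernel w.1 = rho].
  by rewrite !inE => /and3P[/forallP h1 /forallP h2 /eqP].
have [_ loopless0 ker0] := WP _ w0W.
have rhoK k : rho (rho k) = rho k.
  by apply/eqP; rewrite -ker0 kernel_eq kernelK.
have rho_p c k : rho (partner c k) != rho k.
  rewrite -ker0 kernel_eq /partner; case: ifP => _; first by rewrite eq_sym.
  by rewrite -{2}(ord_predK k).
set M := [set rho k | k in I].
have injM w : w \in W -> {in M &, injective w.1}.
  move=> /WP[_ _ kerw] _ _ /imsetP[k _ ->] /imsetP[l _ ->] /eqP.
  by rewrite -kernel_eq kerw !rhoK => /eqP.
have MX : #|M| <= #|X| by rewrite -(card_in_imset (injM _ w0W)) max_card.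
have M_le : #|M| <= n.*2 by rewrite -[leqRHS](card_ord n.*2) max_card.
have X_gt0 : 0 < #|X|.
  have k0 : I by apply: (@Ordinal _ 0); rewrite double_gt0.
  by apply/card_gt0P; exists (w0.1 k0).
have [D0 D0_le D0P] := half_determining_set (partnerK false) rhoK (rho_p false).
have [D1 D1_le D1P] := half_determining_set (partnerK true) rhoK (rho_p true).
pose Q0 : {set {ffun I -> X}} := [set w.1 | w in W].
pose Q1 : {set {ffun I -> X}} := [set image_walk w | w in W].
have Q0_le : #|Q0| <= #|X| ^ #|D0|.
  apply: card_rigid_le => _ _ /imsetP[w wW ->] /imsetP[v vW ->] eqD.
  have [[wS _ kerw] [vS _ kerv]] := (WP _ wW, WP _ vW).
  apply/ffunP; apply: (D0P _ _ _ _ _ _ eqD) => [k|k|].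
  - by rewrite -kerw kernelK.
  - by rewrite -kerv kernelK.
  - apply: partner_determined => k kc; [have := wS k | have := vS k];
    by rewrite /step kc.
have Q1_le : #|Q1| <= #|X| ^ #|D1|.
  apply: card_rigid_le => _ _ /imsetP[w wW ->] /imsetP[v vW ->] eqD.
  have [[wS _ kerw] [vS _ kerv]] := (WP _ wW, WP _ vW).
  apply/ffunP; apply: (D1P _ _ _ _ _ _ eqD) => [k|k|].
  - by rewrite !ffunE -kerw kernelK.
  - by rewrite !ffunE -kerv kernelK.
  - apply: partner_determined => k kc; [have := wS k | have := vS k];
    by rewrite /step kc !ffunE.
pose h w := (w.1, image_walk w).
have fiber_le q : q \in h @: W ->
    \sum_(w in W | h w == q) 1 <= (#|X| - #|M|)`!.
  case/imsetP => v vW ->; rewrite sum1dep_card.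
  apply: leq_trans (card_perm_prescribed_le (image_walk v) (injM _ vW)).
  rewrite -(@card_in_imset _ _ snd); last first.
    move=> [i s] [j t]; rewrite !inE => /andP[_ /eqP[-> _]] /andP[_ /eqP[-> _]].
    by move=> /= ->.
  apply/subset_leq_card/subsetP => _ /imsetP[w + ->].
  rewrite !inE => /andP[_ /eqP[<- /ffunP eq_im]]; apply/forall_inP => k _.
  by rewrite -eq_im ffunE.
have W_le : #|W| <= #|X| ^ (#|D0| + #|D1|) * (#|X| - #|M|)`!.
  rewrite -sum1_card (partition_big_imset h) /=.
  apply: (@leq_trans (\sum_(q in h @: W) (#|X| - #|M|)`!)); first exact: leq_sum.
  rewrite sum_nat_const.
  rewrite leq_mul2r expnD; apply/orP; right.
  apply: leq_trans (leq_mul Q0_le Q1_le); rewrite -cardsX.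
  apply/subset_leq_card/subsetP => _ /imsetP[w wW ->].
  by rewrite inE /= !imset_f.
apply: leq_trans W_le _.
apply: leq_trans (_ : #|X| ^ #|M| * (#|X| - #|M|)`! <= _).
  rewrite leq_mul2r leq_pexp2l ?orbT // -leq_double doubleD -(addnn #|M|).
  exact: leq_add.
apply: leq_trans (expn_fact_le MX) _.
by rewrite leq_mul2r leq_fact ?orbT.
Qed.

Lemma sum_card_closed_walks_le :
  \sum_(s : {perm X}) #|closed_walks s| <=
    (\sum_(k < n.*2) #|[set x | b k x x]|
       + n.*2 ^ n.*2 * (n.*2)`!) * #|X|`!.
Proof.
pose L := fun s (k : I) => [set i in closed_walks s | i k == i (ordS k)].
pose S := fun s => [set i in closed_walks s | [forall k : I, i k != i (ordS k)]].
have split_walks s : #|closed_walks s| <= \sum_(k < n.*2) #|L s k| + #|S s|.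
  have -> : closed_walks s = (\bigcup_(k : I) L s k) :|: S s.
    apply/setP => i; rewrite !inE; apply/idP/orP => [iW|[]]; last by case/andP.
      have [loopless|] := boolP [forall k : I, i k != i (ordS k)].
        by right; rewrite iW.
      rewrite negb_forall => /existsP[k]; rewrite negbK => loop_k; left.
      by apply/bigcupP; exists k; rewrite // !inE iW.
    by case/bigcupP => k _ /setIdP[]; rewrite inE.
  apply: leq_trans (leq_card_setU _ _) _; rewrite leq_add2r.
  elim/big_ind2: _ => [|A a C c hA hC|//]; first by rewrite cards0.
  exact: leq_trans (leq_card_setU _ _) (leq_add hA hC).
apply: (@leq_trans (\sum_(s : {perm X}) (\sum_(k < n.*2) #|L s k| + #|S s|))).
  by apply: leq_sum => s _; apply: split_walks.
rewrite big_split mulnDl; apply: leq_add.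
  apply: leq_trans (_ : \sum_(s : {perm X}) \sum_(k < n.*2) #|[set x | b k x x]| <= _).
    by apply: leq_sum => s _; apply: leq_sum => k _; apply: card_walks_loop_le.
  rewrite sum_nat_const mulnC leq_mul2l -[#|X|]cardsT -card_perm.
  by apply/orP; right; apply/eq_leq/esym/eq_card => s; apply/subsetP.
have sum_S : \sum_(s : {perm X}) #|S s| =
    \sum_(rho : {ffun I -> I}) #|loopless_walks rho|.
  under eq_bigr do rewrite -sum1_card.
  under [RHS]eq_bigr do rewrite -sum1_card.
  rewrite pair_big_dep /= (partition_big (fun w => kernel w.2) predT) //=.
  apply: eq_bigr => rho _; rewrite (reindex (fun w => (w.2, w.1))) /=.
    by apply: eq_bigl => w; rewrite !inE andbA.
  by exists (fun w => (w.2, w.1)) => -[].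
rewrite sum_S.
apply: (@leq_trans (\sum_(rho : {ffun I -> I}) ((n.*2)`! * #|X|`!))).
  by apply: leq_sum => rho _; apply: card_loopless_walks_le.
by rewrite sum_nat_const card_ffun !card_ord mulnA.
Qed.
End ClosedWalks.

Local Open Scope ring_scope.
Local Open Scope complex_scope.
Local Open Scope sesquilinear_scope.

(** * Traces of alternating products as numbers of walks *)

Section PartialPermutationMatrices.
Variables (R : realType) (d : nat).
Implicit Types A B : 'M[R[i]]_d.

Definition mx_rel A : rel 'I_d := fun u v => A u v != 0.

Lemma partial_permP A :
  partial_perm_mx A <->
  (forall u v, A u v = 0 \/ A u v = 1) /\ partial_inj (mx_rel A).
Proof.
split=> [[A01 rowA colA]|[A01 [funA injA]]]; split=> //.
- split=> x y z h1 h2.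
    by apply: (card_le1_eqP (rowA x)); rewrite inE.
  by apply: (card_le1_eqP (colA z)); rewrite inE.
- by move=> u; apply/card_le1_eqP => v w; rewrite !inE => h1 h2; exact: funA _ _ _ h2 h1.
- by move=> v; apply/card_le1_eqP => u w; rewrite !inE => h1 h2; exact: injA _ _ _ h2 h1.
Qed.

Lemma mulmx_neq0 A B u w :
  (A *m B) u w != 0 -> exists2 v, A u v != 0 & B v w != 0.
Proof.
rewrite mxE => AB; have [/existsP[v /andP[Av Bv]]|] :=
  boolP [exists v, (A u v != 0) && (B v w != 0)]; first by exists v.
rewrite negb_exists => /forallP nAB; case/eqP: AB; apply: big1 => v _.
by apply/eqP; rewrite mulf_eq0 -[_ || _]negbK negb_or nAB.
Qed.

Lemma partial_perm_mulmx A B :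
  partial_perm_mx A -> partial_perm_mx B -> partial_perm_mx (A *m B).
Proof.
move=> /partial_permP[A01 [funA injA]] /partial_permP[B01 [funB injB]].
apply/partial_permP; split=> [u w|].
  rewrite mxE; have [/existsP[v Av]|] := boolP [exists v, A u v != 0].
    rewrite (bigD1 v) //= big1 => [|v' v'v].
      by rewrite addr0; case: (A01 u v) Av => -> //; rewrite ?eqxx ?mul1r.
    apply/eqP; rewrite mulf_eq0; apply/orP; left; apply: contraNT v'v => Av'.
    by apply/eqP; exact: funA _ _ _ Av' Av.
  rewrite negb_exists => /forallP nA; left; apply: big1 => v _.
  by have /negPn/eqP-> := nA v; rewrite mul0r.
split=> x y z /mulmx_neq0[v Av Bv] /mulmx_neq0[v' Av' Bv'].
  by move: Bv'; rewrite -(funA _ _ _ Av Av'); apply: funB.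
by move: Av'; rewrite -(injB _ _ _ Bv Bv'); apply: injA.
Qed.

Lemma partial_perm1 : partial_perm_mx (1%:M : 'M[R[i]]_d).
Proof.
apply/partial_permP; split=> [u v|].
  by rewrite mxE; case: eqP; [right|left].
have rel1 u v : mx_rel 1%:M u v -> u = v.
  by rewrite /mx_rel mxE; case: (u =P v) => //; rewrite eqxx.
by split=> x y z /rel1-> /rel1->.
Qed.

Lemma perm_conjmxE (s : 'S_d) A u v :
  (perm_mx s *m A *m (perm_mx s)^t* ) u v = A (s u) (s v).
Proof.
have -> : (perm_mx s)^t* = (perm_mx s)^T :> 'M[R[i]]_d.
  by apply/matrixP => x y; rewrite !mxE conjC_nat.
by rewrite tr_perm_mx -mulmxA -col_permE -row_permE !mxE.
Qed.

Lemma partial_perm_conjmx (s : 'S_d) A :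
  partial_perm_mx A -> partial_perm_mx (perm_mx s *m A *m (perm_mx s)^t* ).
Proof.
move=> /partial_permP[A01 [funA injA]]; apply/partial_permP.
split=> [u v|]; first by rewrite perm_conjmxE.
split=> x y z; rewrite /mx_rel !perm_conjmxE => h1 h2; apply: (@perm_inj _ s).
  exact: funA _ _ _ h1 h2.
exact: injA _ _ _ h1 h2.
Qed.

Lemma mxtrace_partial_perm A :
  partial_perm_mx A -> \tr A = #|[set x | mx_rel A x x]|%:R.
Proof.
case=> A01 _ _; rewrite -sum1dep_card natr_sum big_mkcond /=.
by apply: eq_bigr => x _; rewrite /mx_rel; case: (A01 x x) => ->; rewrite ?eqxx ?oner_eq0.
Qed.

Variable B : nat -> 'M[R[i]]_d.
Hypothesis BP : forall j, (0 < j)%N -> partial_perm_mx (B j).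

(** The factors are numbered from 1, the steps of a walk from 0. *)
Definition factor_rel (k : nat) : rel 'I_d := mx_rel (B k.+1).

(** The product stays a 0-1 matrix, so a nonzero entry needs no count of the
    walks behind it: the existence of one is enough. *)
Lemma alt_prod_walk (s : 'S_d) (n : nat) :
  partial_perm_mx (alt_prod n B (perm_mx s)) /\
  forall x z, alt_prod n B (perm_mx s) x z != 0 ->
    exists f : nat -> 'I_d, [/\ f 0%N = x, f n.*2 = z &
      forall k, (k < n.*2)%N -> step factor_rel s k (f k) (f k.+1)].
Proof.
elim: n => [|n [IHP IHw]].
  rewrite /alt_prod big_ord0; split; first exact: partial_perm1.
  by move=> x z; rewrite mxE; case: (x =P z) => [->|]; [exists (fun=> z)|rewrite eqxx].
rewrite /alt_prod big_ord_recr -/(alt_prod n B _) /=; split.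
  apply: partial_perm_mulmx => //; apply: partial_perm_mulmx; first exact: BP.
  exact/partial_perm_conjmx/BP.
move=> x z /mulmx_neq0[y /IHw[f [f0 fn fs]]] /mulmx_neq0[y' Bodd].
rewrite perm_conjmxE => Beven.
(* The walk for the first n pairs of factors, extended by two vertices. *)
exists (fun k => if (k <= n.*2)%N then f k else if k == n.*2.+1 then y' else z).
split=> [//||k]; first by rewrite doubleS ltnNge leqnSn /= eqn_leq ltnn.
rewrite doubleS !ltnS => k_le.
have [kn|kn|->] := ltngtP k n.*2; first exact: fs.
  have -> : k = n.*2.+1 by apply/eqP; rewrite eqn_leq k_le.
  by rewrite /step /factor_rel /= odd_double eqxx gtn_eqF.
by rewrite /step /factor_rel odd_double eqxx fn.
Qed.

Lemma mxtrace_alt_prod_le (s : 'S_d) (n : nat) : (0 < n)%N ->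
  exists2 m : nat, \tr (alt_prod n B (perm_mx s)) = m%:R &
    (m <= #|closed_walks n factor_rel s|)%N.
Proof.
move=> n_gt0; have [prodP walkP] := alt_prod_walk s n.
eexists; first exact: mxtrace_partial_perm.
have n2_gt0 : (0 < n.*2)%N by rewrite double_gt0.
pose start (i : {ffun 'I_(n.*2) -> 'I_d}) := i (Ordinal n2_gt0).
apply: leq_trans (leq_imset_card start _).
apply/subset_leq_card/subsetP => x; rewrite inE => /walkP[f [f0 fn fs]].
apply/imsetP; exists [ffun k : 'I_(n.*2) => f k]; last by rewrite /start ffunE.
rewrite inE; apply/forallP => k; rewrite !ffunE /=.
have -> : f (k.+1 %% n.*2)%N = f k.+1; last exact: fs.
have := ltn_ord k; rewrite leq_eqVlt => /predU1P[->|/modn_small-> //].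
by rewrite modnn f0 fn.
Qed.

Lemma ntr_partial_perm A :
  partial_perm_mx A -> ntr A = d%:R^-1 * #|[set x | mx_rel A x x]|%:R.
Proof. by move=> AP; rewrite /ntr mxtrace_partial_perm. Qed.

Lemma perm_mean_alt_prod_ge0 (n : nat) : (0 < n)%N ->
  0 <= perm_mean (fun U => ntr (alt_prod n B U)).
Proof.
move=> n_gt0; rewrite mulr_ge0 ?invr_ge0 ?ler0n // sumr_ge0 // => s _.
have [m mE _] := mxtrace_alt_prod_le s n_gt0.
by rewrite /ntr mE mulr_ge0 ?invr_ge0 ?ler0n.
Qed.

Lemma perm_mean_alt_prod_le (n : nat) : (0 < n)%N ->
  perm_mean (fun U => ntr (alt_prod n B U)) <=
    \sum_(k < n.*2) ntr (B k.+1) + (n.*2 ^ n.*2 * (n.*2)`!)%:R * d%:R^-1.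
Proof.
move=> n_gt0; set K := (_ * _)%N.
have walks_le : (\sum_(s : 'S_d) #|closed_walks n factor_rel s| <=
    (\sum_(k < n.*2) #|[set x | factor_rel k x x]| + K) * d`!)%N.
  have := @sum_card_closed_walks_le _ n factor_rel n_gt0.
  rewrite card_ord; apply => k _.
  by have /partial_permP[] := BP (ltn0Sn k).
have -> : \sum_(k < n.*2) ntr (B k.+1) + K%:R * d%:R^-1 =
    (d`!)%:R^-1 * (d%:R^-1 *
      ((\sum_(k < n.*2) #|[set x | factor_rel k x x]| + K) * d`!)%N%:R) :> R[i].
  have fact_neq0 : (d`!)%:R != 0 :> R[i] by rewrite pnatr_eq0 -lt0n fact_gt0.
  rewrite natrM natrD natr_sum [_ * (d`!)%:R]mulrC mulrCA mulKf //.
  rewrite mulrDr mulr_sumr; congr (_ + _); last by rewrite mulrC.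
  by apply: eq_bigr => k _; rewrite ntr_partial_perm //; apply: BP.
rewrite /perm_mean ler_wpM2l ?invr_ge0 ?ler0n //.
rewrite /ntr -mulr_sumr ler_wpM2l ?invr_ge0 ?ler0n //.
apply: le_trans (_ : (\sum_(s : 'S_d) #|closed_walks n factor_rel s|)%N%:R <= _).
  rewrite natr_sum ler_sum // => s _.
  by have [m -> m_le] := mxtrace_alt_prod_le s n_gt0; rewrite ler_nat.
by rewrite ler_nat.
Qed.

End PartialPermutationMatrices.

From mathcomp Require Import all_classical all_reals all_analysis.

Import numFieldNormedType.Exports.

Local Open Scope complex_scope.
Local Open Scope classical_set_scope.

(** * The bound and the limit *)

Lemma ntr_partial_perm_ReK (R : realType) d (A : 'M[R[i]]_d) :
  partial_perm_mx A -> ntr A = (complex.Re (ntr A))%:C.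
Proof.
move=> AP; have : ntr A \is Num.real.
  by rewrite ntr_partial_perm // ger0_real // mulr_ge0 ?invr_ge0 ?ler0n.
by move=> /RRe_real ->.
Qed.

Lemma ntr_le_max (R : realType) (n d : nat) (B : nat -> 'M[R[i]]_d) (k : nat) :
  (k < n.*2)%N -> complex.Re (ntr (B k.+1)) <= max_ntr n B.
Proof.
move=> kn; rewrite /max_ntr; apply: (le_bigmax_seq _ k.+1 xpredT (fun j => complex.Re (ntr (B j)))) => //.
by rewrite mem_index_iota.
Qed.

Lemma cvg_natr_div (R : realType) (K : nat) :
  (fun d : nat => K%:R * d%:R^-1 : (R[i])^o) @ \oo --> (0 : (R[i])^o).
Proof.
apply/cvgr0Pnorm_lt => e e_gt0.
have eE : (complex.Re e)%:C = e by rewrite RRe_real // gtr0_real.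
have re_gt0 : 0 < complex.Re e by rewrite -ltcR eE.
near=> d.
have d_gt0 : 0 < d%:R :> R by rewrite ltr0n; near: d; exists 1%N.
rewrite ger0_norm ?mulr_ge0 ?invr_ge0 ?ler0n // -eE.
rewrite -(rmorph_nat (real_complex R) K) -(rmorph_nat (real_complex R) d).
rewrite -fmorphV -rmorphM ltcR ltr_pdivrMr // mulrC -ltr_pdivrMr //.
by near: d; exact: nbhs_infty_gtr.
Unshelve. all: by end_near. Qed.

Lemma cvg0_sum (R : realType) (m : nat) (u : nat -> nat -> (R[i])^o) :
  (forall k, u k @ \oo --> (0 : (R[i])^o)) ->
  (fun d => \sum_(k < m) u k d) @ \oo --> (0 : (R[i])^o).
Proof.
move=> u0; elim: m => [|m IH].
  by under eq_fun do rewrite big_ord0; apply: cvg_cst.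
under eq_fun do rewrite big_ord_recr /=.
have := cvgD IH (u0 m); rewrite addr0; exact.
Qed.

Lemma cvg0_le (R : realType) (u v : nat -> R[i]) :
  (\forall d \near \oo, 0 <= u d <= v d) ->
  ((v : nat -> (R[i])^o) @ \oo --> (0 : (R[i])^o)) ->
  ((u : nat -> (R[i])^o) @ \oo --> (0 : (R[i])^o)).
Proof.
move=> uv v0; apply/cvgr0Pnorm_lt => e e0.
apply: (filterS2 _ _ uv (cvgr0_norm_lt _ v0 _ e0)) => d /andP[u0 u_le].
by apply: le_lt_trans; rewrite !ger0_norm // (le_trans u0 u_le).
Qed.

Theorem theorem2p1 (R : realType) (n : nat) (hn : (0 < n)%N) :
  exists Cn Dn : R,
    forall B : nat -> forall d : nat, 'M[R[i]]_d,
      (forall j d : nat, (0 < j)%N -> (0 < d)%N -> partial_perm_mx (B j d)) ->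
      (forall d : nat, (0 < d)%N ->
         perm_mean (fun U => ntr (alt_prod n (fun j => B j d) U))
           <= (Cn * max_ntr n (fun j => B j d) + Dn * d%:R^-1)%:C) /\
      ((forall j : nat, (0 < j)%N ->
          (fun d : nat => ntr (B j d) : (R[i])^o) @ \oo --> (0 : (R[i])^o)) ->
       (fun d : nat =>
          perm_mean (fun U => ntr (alt_prod n (fun j => B j d) U)) : (R[i])^o)
         @ \oo --> (0 : (R[i])^o)).
Proof.
set K := (n.*2 ^ n.*2 * (n.*2)`!)%N.
exists (n.*2)%:R, K%:R => B BP; split.
  move=> d d_gt0; have BdP j : (0 < j)%N -> partial_perm_mx (B j d).
    by move=> j_gt0; apply: BP.
  apply: le_trans (perm_mean_alt_prod_le BdP hn) _; rewrite -/K.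
  rewrite rmorphD /= !rmorphM /= fmorphV !rmorph_nat lerD2r.
  apply: (@le_trans _ _ (\sum_(k < n.*2) (max_ntr n (fun j => B j d))%:C)).
    apply: ler_sum => k _; rewrite (ntr_partial_perm_ReK (BdP k.+1 isT)) lecR.
    exact: (ntr_le_max (fun j => B j d)).
  by rewrite sumr_const card_ord mulr_natl.
move=> B0.
apply: (@cvg0_le _ _ (fun d => \sum_(k < n.*2) ntr (B k.+1 d) + K%:R * d%:R^-1)).
  exists 1%N => // d /= d_gt0.
  have BdP j : (0 < j)%N -> partial_perm_mx (B j d) by move=> j_gt0; apply: BP.
  by rewrite perm_mean_alt_prod_ge0 //= perm_mean_alt_prod_le.
have sum_ntr0 := @cvg0_sum _ n.*2 (fun k d => ntr (B k.+1 d)) (fun k => B0 k.+1 isT).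
have := cvgD sum_ntr0 (@cvg_natr_div R K); rewrite addr0; exact.
Qed.
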